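(* Let $w\in S_n$, and let the pillar entries of the rank matrix $r(w)$ be numbered $1,\dots,N$ in lexicographic order of their positions $(p_1,q_1),\dots,(p_N,q_N)$, with values $K_i=r_{p_iq_i}(w)$, and let $k_i$ be the associated numbers defined in the context. Then $$\operatorname{codim}(\mathcal{C}_w)=\sum_{i=1}^N k_i\,(K_i+n-p_i-q_i).$$
   Context: $\mathcal{F}$ is the variety of complete flags $V_0\subset V_1\subset\cdots\subset V_n=\mathbb{C}^n$, of dimension $n(n-1)/2$. With $\varepsilon_1,\dots,\varepsilon_n$ the standard basis and $B$ the group of upper-triangular matrices, the Schubert cell $\mathcal{C}_w$ is the $B$-orbit of the flag with $V_k=\langle\varepsilon_{w(1)},\dots,\varepsilon_{w(k)}\rangle$. Its dimension is the Coxeter length $\ell(w)$, so $\operatorname{codim}(\mathcal{C}_w)=\frac{n(n-1)}2-\ell(w)=\#\{i<j : w(i)<w(j)\}$. The rank matrix is $r(w)=(r_{ij}(w))_{0\le i,j\le n}$ with $r_{ij}(w)=\#\{k\le i: w(k)\le j\}$. An entry $r_{ij}$ ($1\le i,j\le n-1$) is a pillar entry if $r_{ij}=r_{i-1,j}+1=r_{i,j-1}+1$ and $r_{ij}=r_{i+1,j}=r_{i,j+1}$. The pillar entries are numbered from left to right in each row, rows being taken from top to bottom; $(p_i,q_i)$ (row, column) is the position of the $i$-th pillar and $K_i$ its value. The dots of the diagram of $w$ are the points $(k,w(k))$, $1\le k\le n$. Let $NW_i$ be the North-West region of the $i$-th pillar, so that a dot $(k,w(k))$ lies in $NW_i$ iff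 $k\le p_i$ and $w(k)\le q_i$; there are exactly $K_i$ dots in $NW_i$. Then $k_i=K_i-L_i$, where $L_i$ is the number of dots in $NW_i$ that also lie in $NW_1\cup\dots\cup NW_{i-1}$; in other words $k_i$ is the number of dots in $NW_i\setminus(NW_1\cup\dots\cup NW_{i-1})$. *)

(* Defs.v *)
From HB Require Import structures.
From mathcomp Require Import all_boot all_order all_algebra all_fingroup.
From mathcomp Require Import complex mpoly.
From mathcomp Require Import boolp classical_sets reals.

Set Implicit Arguments.
Unset Strict Implicit.
Unset Printing Implicit Defensive.

Import Order.TTheory GRing.Theory Num.Theory.

(* Positions (i, j) of the rank matrix and of its pillars are the usual ones,
   0 <= i, j <= n.  The ordinals on which w : 'S_n acts start at 0 instead: the
   ordinal k stands for the integer k + 1, so "k <= i" for integers becomes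
   "k < i" for ordinals. *)
Section Pillars.
Variables (n : nat) (w : 'S_n).
Local Open Scope nat_scope.

Definition rank_entry (i j : nat) : nat :=
  #|[set k : 'I_n | (k < i) && (w k < j)]%SET|.

Definition is_pillar (i j : nat) : bool :=
  [&& 1 <= i <= n.-1, 1 <= j <= n.-1,
      rank_entry i j == rank_entry i.-1 j + 1,
      rank_entry i j == rank_entry i j.-1 + 1,
      rank_entry i j == rank_entry i.+1 j &
      rank_entry i j == rank_entry i j.+1].

(* [seq _ | i <- _, j <- _] is listed in row-major, i.e. lexicographic, order *)
Definition pillars : seq (nat * nat) :=
  [seq x <- [seq (i, j) | i <- iota 1 n.-1, j <- iota 1 n.-1]
  | is_pillar x.1 x.2].

Definition pillar_row (i : nat) : nat := (nth (0, 0) pillars i).1.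
Definition pillar_col (i : nat) : nat := (nth (0, 0) pillars i).2.
Definition pillar_val (i : nat) : nat :=
  rank_entry (pillar_row i) (pillar_col i).

(* the dot (k, w k) is represented by k *)
Definition NW (i : nat) : {set 'I_n} :=
  [set k : 'I_n | (k < pillar_row i) && (w k < pillar_col i)]%SET.

Definition pillar_L (i : nat) : nat :=
  #|[set k in NW i | [exists j : 'I_i, k \in NW j]]%SET|.

Definition pillar_k (i : nat) : int :=
  ((pillar_val i)%:Z - (pillar_L i)%:Z)%R.

End Pillars.

Local Open Scope classical_set_scope.
Local Open Scope ring_scope.

(* Krull dimension of a subspace X of a topological space T, the topology being
   given by the predicate "closed" on subsets of T. *)
Section KrullDimension.
Variables (T : Type) (closed : set T -> Prop).

Definition closed_in (X A : set T) : Prop :=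
  exists2 Z, closed Z & A = X `&` Z.

Definition irreducible_set (A : set T) : Prop :=
  A !=set0 /\
  forall A1 A2, closed_in A A1 -> closed_in A A2 -> A = A1 `|` A2 ->
    A = A1 \/ A = A2.

Definition irreducible_chain (X : set T) (d : nat) : Prop :=
  exists Z : nat -> set T,
    (forall i, (i <= d)%N -> closed_in X (Z i) /\ irreducible_set (Z i)) /\
    (forall i, (i < d)%N -> Z i `<` Z i.+1).

Definition krull_dim (X : set T) (d : nat) : Prop :=
  irreducible_chain X d /\ forall e, irreducible_chain X e -> (e <= d)%N.

End KrullDimension.

Section Flags.
Variables (R : realType) (n : nat).
Local Notation C := R[i].

Definition family := {ffun 'I_n.+1 -> {vspace 'cV[C]_n}}.

Definition flag_variety : set family :=
  [set V : family |
    (forall k : 'I_n.+1, (\dim (V k) = k)%N) /\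
    (forall k l : 'I_n.+1, (k <= l)%N -> (V k <= V l)%VS)].

Definition coordinate_flag (w : 'S_n) : family :=
  [ffun k : 'I_n.+1 =>
    <<[seq (delta_mx (w j) ord0 : 'cV[C]_n)
      | j : 'I_n <- enum 'I_n & (j < k)%N]>>%VS].

Definition flag_act (g : 'M[C]_n) (V : family) : family :=
  [ffun k => (linfun (mulmx g : 'cV[C]_n -> 'cV[C]_n) @: V k)%VS].

(* is_trig_mx is lower triangularity, hence the transpose *)
Definition borel : set 'M[C]_n :=
  [set b | b \in unitmx /\ is_trig_mx b^T].

Definition schubert_cell (w : 'S_n) : set family :=
  [set flag_act b (coordinate_flag w) | b in borel].

Definition mx_eval (p : {mpoly C[n * n]}) (g : 'M[C]_n) : C :=
  p.@[fun i => mxvec g ord0 i].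

(* Zariski topology of the flag variety as the quotient of GL_n by B, along
   g |-> g . (standard flag): Z is closed iff its preimage is cut out in GL_n by
   polynomials in the matrix entries.  Families that are not flags are never
   reached, and play no role for subspaces of flag_variety. *)
Definition zariski_closed (Z : set family) : Prop :=
  exists S : set {mpoly C[n * n]}, forall g : 'M[C]_n, g \in unitmx ->
    (Z (flag_act g (coordinate_flag 1%g)) <->
     forall p, S p -> mx_eval p g = 0).

Definition has_codim (X : set family) (c : int) : Prop :=
  exists dX dF : nat,
    [/\ krull_dim zariski_closed X dX,
        krull_dim zariski_closed flag_variety dF &
        c = dF%:Z - dX%:Z].

End Flags.

Arguments schubert_cell R {n} w.

(* Main.v *)
Require Import Defs.
From HB Require Import structures.
From mathcomp Require Import all_boot all_order all_algebra all_fingroup.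
From mathcomp Require Import complex mpoly.
From mathcomp Require Import boolp classical_sets reals.
From mathcomp Require Import zify.

(** Two things have to be shown: that the Krull dimensions of the flag variety
and of the cell of w are the numbers of pairs i < j, respectively of inversions
of w, and that the pillars count the non-inversions of w.

Upper bounds on dimensions.  Everything is lifted from flags to GL_n along
g |-> g . (standard flag), whose fibres are the cosets g B.  An irreducible set
of flags has a prime vanishing ideal upstairs ([flag_preimage_prime]): for a
polynomial p, the flags whose whole coset is killed by p form a closed set, and
if p q vanishes on a coset, then p or q does.  A chain of irreducible sets
therefore gives a chain of prime ideals, which can be prolonged inside a single
coset by dim B more steps ([borel_coset_chain]).  If the preimage is moreover
parametrised by polynomials in D variables, such a chain has length at most D
([prime_chain_le]): elements f_i lying in one ideal of the chain but not in the
next satisfy no polynomial relation, so for every m their monomials with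
exponents below m give m^e independent polynomials of degree O(m) in D
variables, whereas that space has dimension O(m^D).  The flag variety is
covered by D = n^2 matrix entries; the cell of w by the product of an affine
space of unipotent matrices supported on the inversions of w
([schubert_cellP]) and of B.

Lower bounds.  That affine space is filtered by coordinate subspaces.  Each
coordinate is, on the cell, a minor of the first columns of the matrix, which
B only rescales ([cell_coordinate_exists]); hence the coordinate subspaces are
closed in the cell.  They are irreducible because they contain the lines
through their points ([line_dense_mul]).  For the flag variety, take closures
of such a chain in the cell of the longest permutation.

Pillars.  Between a dot a and a dot b South-East of it there is always a
pillar ([pillar_between]).  Consequently, when (p, q) is the first pillar with
a in its North-West region, the dots South-East of a are exactly those South-East
of (p, q) ([first_pillar_SE_dots]), and inclusion-exclusion counts
r_pq + n - p - q of them.  Summing over the dots a, sorted according to their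
first pillar, counts every non-inversion of w exactly once. *)

Set Implicit Arguments.
Unset Strict Implicit.
Unset Printing Implicit Defensive.

Import Order.TTheory GRing.Theory Num.Theory.
Local Open Scope ring_scope.

(** * Chains of prime ideals in algebras of polynomial functions *)
Section PrimeChains.
Variables (K : fieldType) (S : comAlgType K).

Record prime_ideal (I : S -> Prop) : Prop := PrimeIdeal {
  prime_idealD : forall x y, I x -> I y -> I (x + y);
  prime_idealM : forall x y, I y -> I (x * y);
  prime_ideal1 : ~ I 1;
  prime_idealP : forall x y, I (x * y) -> I x \/ I y }.

(** Chains grow towards smaller ideals, that is, larger irreducible sets; the
witness [f] of each strict inclusion is what the dimension count uses. *)
Inductive prime_chain : (S -> Prop) -> nat -> Prop :=
| PrimeChain0 I : prime_ideal I -> prime_chain I 0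
| PrimeChainS I J f e : prime_chain I e -> prime_ideal J ->
    (forall x, J x -> I x) -> I f -> ~ J f -> prime_chain J e.+1.

Lemma prime_chain_prime I e : prime_chain I e -> prime_ideal I.
Proof. by case. Qed.

(** The last ideal of a chain may be shrunk, which is how a chain found inside
one coset is glued below a chain of sets of flags. *)
Lemma prime_chainW I J e : prime_chain I e -> prime_ideal J ->
  (forall x, J x -> I x) -> prime_chain J e.
Proof.
case=> [{}I _|{}I I' f {}e cI _ sI If nI'f] pJ sJ; first exact: PrimeChain0.
by apply: (PrimeChainS (f := f) cI) => // [x /sJ /sI|/sJ].
Qed.

Definition free_mod (I : S -> Prop) (A : finType) (g : A -> S) : Prop :=
  forall c : A -> K, I (\sum_a c a *: g a) -> forall a, c a = 0.

(** A relation between the products g_a f^k modulo J is a polynomial in f.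
Modulo I only its constant term survives, and this vanishes by freeness of g;
the rest is divisible by f, which can be cancelled because J is prime and does
not contain f. *)
Lemma free_modX (I J : S -> Prop) f (A : finType) (g : A -> S) m :
  prime_ideal I -> prime_ideal J -> (forall x, J x -> I x) -> I f -> ~ J f ->
  free_mod I g ->
  free_mod J (fun ak : A * 'I_m => g ak.1 * f ^+ ak.2).
Proof.
move=> pI pJ sJI If nJf gI c.
have IN x : I x -> I (- x) by move=> Ix; rewrite -mulN1r; apply: (prime_idealM pI).
suff h (d : A -> nat -> K) : J (\sum_(k < m) \sum_a d a k *: (g a * f ^+ k)) ->
    forall a (k : 'I_m), d a k = 0.
  move=> Jc [a k].
  pose d a (k : nat) := if insub k is Some k' then c (a, k') else 0.
  have dE b (j : 'I_m) : d b j = c (b, j) by rewrite /d valK.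
  rewrite -dE; apply: h; rewrite exchange_big pair_bigA /=.
  by under eq_bigr do rewrite dE -surjective_pairing.
elim: {c} m d => [|m IHm] d; first by move=> _ a [].
set h := \sum_(k < m) \sum_a d a k.+1 *: (g a * f ^+ k).
have -> : \sum_(k < m.+1) \sum_a d a k *: (g a * f ^+ k) =
          \sum_a d a 0 *: g a + h * f.
  rewrite big_ord_recl; congr (_ + _).
    by apply: eq_bigr => a _; rewrite expr0 mulr1.
  rewrite mulr_suml; apply: eq_bigr => k _; rewrite mulr_suml.
  by apply: eq_bigr => a _; rewrite lift0 exprSr -scalerAl mulrA.
move=> Jd.
have d0 a : d a 0 = 0.
  apply: (gI (fun a => d a 0)).
  rewrite -(addrK (h * f) (\sum_a _)); apply: (prime_idealD pI); first exact: sJI.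
  by apply/IN/(prime_idealM pI).
have [Jh|//] : J h \/ J f.
  apply: (prime_idealP pJ); move: Jd; rewrite big1 ?add0r // => a _.
  by rewrite d0 scale0r.
move=> a k; have := ltn_ord k; case: (nat_of_ord k) => [|j] jm; first exact: d0.
exact: (IHm (fun a k => d a k.+1) Jh a (Ordinal (jm : (j < m)%N))).
Qed.

Section Bound.
Variables (D : nat) (phi : {lrmorphism S -> {mpoly K[D]}}).

Lemma msize_mul_le (p q : {mpoly K[D]}) :
  (msize (p * q) <= (msize p + msize q).-1)%N.
Proof.
have [->|p0] := eqVneq p 0; first by rewrite mul0r msize0.
have [->|q0] := eqVneq q 0; first by rewrite mulr0 msize0.
by rewrite msizeM.
Qed.

Lemma msizeX_le (p : {mpoly K[D]}) k : (msize (p ^+ k) <= (k * msize p).+1)%N.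
Proof.
elim: k => [|k IHk]; first by rewrite expr0 msize1.
rewrite exprS (leq_trans (msize_mul_le _ _)) // mulSn.
by move: (msize p) (msize (p ^+ k)) IHk => x y; lia.
Qed.

(** The monomials with exponents below m in the witnesses of the chain. *)
Lemma prime_chain_free I e : prime_chain I e ->
  exists c : nat, forall m, exists (A : finType) (g : A -> S),
    [/\ #|A| = (m ^ e)%N, free_mod I g &
        forall a, (msize (phi (g a)) <= (c * m).+1)%N].
Proof.
elim=> {e} [{}I pI|{}I J f e cI [c IH] pJ sJI If nJf].
  exists 0%N => m; exists unit, (fun _ => 1); split; first by rewrite card_unit.
    move=> d; rewrite (bigD1 tt) //= big1 ?addr0; last by case.
    move=> I1 []; apply/eqP/negPn/negP => d0.
    apply: (prime_ideal1 pI).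
    rewrite -[1](scalerK d0) -mulr_algl; exact: (prime_idealM pI).
  by move=> _; rewrite rmorph1 msize1.
exists (c + msize (phi f))%N => m; have [A [g [cardA gI sg]]] := IH m.
exists (A * 'I_m)%type, (fun ak : A * 'I_m => g ak.1 * f ^+ ak.2); split.
- by rewrite card_prod cardA card_ord expnSr.
- by apply: free_modX gI => //; apply: prime_chain_prime cI.
move=> [a k] /=; rewrite rmorphM rmorphXn /= (leq_trans (msize_mul_le _ _)) //.
have := sg a; have := msizeX_le (phi f) k; have := ltn_ord k.
move: (msize _) (msize _) (msize _) => x y z km; nia.
Qed.

Lemma card_bmultinom M : (#|{: 'X_{1..D < M}}| <= M ^ D)%N.
Proof.
pose F (x : 'X_{1..D < M}) : {ffun 'I_D -> option 'I_M} :=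
  [ffun i => insub (bmnm x i)].
have lt (x : 'X_{1..D < M}) i : (bmnm x i < M)%N.
  by apply: leq_ltn_trans (bmdeg x); rewrite mdegE (bigD1 i) //= leq_addr.
pose G (x : 'X_{1..D < M}) : {ffun 'I_D -> 'I_M} :=
  [ffun i => Ordinal (lt x i)].
have Ginj : injective G.
  move=> x y /ffunP eG; apply/val_inj/mnmP => i.
  by have := congr1 val (eG i); rewrite !ffunE.
by rewrite (leq_trans (leq_card G Ginj)) // card_ffun !card_ord.
Qed.

Lemma free_mod_card I (A : finType) (g : A -> S) M :
  (forall x, phi x = 0 -> I x) -> free_mod I g ->
  (forall a, (msize (phi (g a)) <= M)%N) -> (#|A| <= M ^ D)%N.
Proof.
move=> kI gI sg; apply: leq_trans (card_bmultinom M); rewrite leqNgt.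
apply/negP => lt.
pose B := 'X_{1..D < M}.
pose X : 'M[K]_(#|A|, #|{: B}|) :=
  \matrix_(i, j) (phi (g (enum_val i)))@_(bmnm (enum_val j)).
have : kermx X != 0.
  by rewrite kermx_eq0 /row_free neq_ltn (leq_ltn_trans (rank_leq_col X)).
case/rowV0Pn=> v /sub_kermxP vX /negP []; apply/eqP/rowP => i.
rewrite mxE -(enum_valK i); apply: (gI (fun a => v 0 (enum_rank a))).
apply: kI; rewrite raddf_sum /=; apply/mpolyP => u; rewrite mcoeff0 raddf_sum /=.
case: (ltnP (mdeg u) M) => [uM|Mu]; last first.
  rewrite big1 // => a _; rewrite linearZ /= mcoeffZ memN_msupp_eq0 ?mulr0 //.
  by apply: msize_mdeg_ge; apply: leq_trans (sg a) Mu.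
have := congr1 (fun Z : 'rV_#|{: B}| => Z 0 (enum_rank (BMultinom uM))) vX.
rewrite !mxE => uX; rewrite -[RHS]uX (reindex enum_rank) /=; last first.
  exact: onW_bij (enum_rank_bij A).
apply: eq_bigr => a _; rewrite mxE !enum_rankK linearZ /= mcoeffZ.
by [].
Qed.

(** Growth comparison: m^e independent polynomials in D variables of degree at
most c m force m^e <= (c m + 1)^D for all m. *)
Theorem prime_chain_le I e :
  (forall x, phi x = 0 -> I x) -> prime_chain I e -> (e <= D)%N.
Proof.
move=> kI /prime_chain_free [c H]; rewrite leqNgt; apply/negP => De.
(* (c m + 1)^D is at most (c + 1)^D m^D, hence smaller than m^(D + 1) here. *)
pose m := ((c.+1) ^ D).+1.
have [A [g [cardA gI sg]]] := H m.
have := free_mod_card kI gI sg; rewrite cardA => le1.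
have le2 : ((c * m).+1 ^ D <= (c.+1 * m) ^ D)%N.
  case: (posnP D) => [->|D0] //; rewrite leq_exp2r // mulSn /m; lia.
have le3 : (m ^ D.+1 <= m ^ e)%N by rewrite leq_pexp2l.
have := leq_trans le3 (leq_trans le1 le2).
by rewrite expnMn expnS leq_pmul2r ?expn_gt0 // /m ltnn.
Qed.

End Bound.
End PrimeChains.

(** * Polynomial functions on matrices *)
Section MatrixPolynomials.
Variables (R : realType) (n : nat).
Local Notation C := R[i].
Local Notation poly_fun := {mpoly C[n * n]}.

Definition generic_mx : 'M[poly_fun]_n := \matrix_(i, j) 'X_(mxvec_index i j).

Lemma mx_eval_gen (g : 'M[C]_n) i j : mx_eval (generic_mx i j) g = g i j.
Proof. by rewrite mxE /mx_eval mevalXU mxvecE. Qed.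

Lemma mx_eval_det k (M : 'M[poly_fun]_k) (g : 'M[C]_n) :
  mx_eval (\det M) g = \det (map_mx (fun p => mx_eval p g) M).
Proof. by rewrite /mx_eval -det_map_mx. Qed.

(** Pull-back of polynomial functions along the polynomial map [h] from
D-space to matrices. *)
Definition subst_mx D (h : 'M[{mpoly C[D]}]_n) (p : poly_fun) : {mpoly C[D]} :=
  p \mPo [tuple mxvec h ord0 k | k < n * n].

HB.instance Definition _ D (h : 'M[{mpoly C[D]}]_n) :=
  GRing.LRMorphism.copy (subst_mx h)
    (comp_mpoly [tuple mxvec h ord0 k | k < n * n]).

Lemma meval_subst_mx D (h : 'M[{mpoly C[D]}]_n) p v :
  (subst_mx h p).@[v] = mx_eval p (map_mx (meval v) h).
Proof.
rewrite /subst_mx comp_mpoly_meval /mx_eval; apply: meval_eq => k.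
by rewrite tnth_mktuple -map_mxvec mxE.
Qed.

Lemma mx_eval_subst (h : 'M[poly_fun]_n) p g :
  mx_eval (subst_mx h p) g = mx_eval p (map_mx (fun q => mx_eval q g) h).
Proof. exact: meval_subst_mx. Qed.

Lemma mx_eval_line (p : poly_fun) (x y : 'M[C]_n) :
  exists P : {poly C}, forall t, P.[t] = mx_eval p (x + t *: (y - x)).
Proof.
pose h k : {poly C} := (mxvec x ord0 k)%:P + (mxvec (y - x) ord0 k) *: 'X.
exists (\sum_(m <- msupp p) p@_m *: \prod_i h i ^+ m i) => t.
rewrite /mx_eval mevalE horner_sum; apply: eq_bigr => m _.
rewrite hornerZ horner_prod; congr (_ * _); apply: eq_bigr => i _.
rewrite horner_exp /h !hornerE; congr (_ ^+ _).
by case/mxvec_indexP: i => j k; rewrite !mxvecE !mxE mulrC.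
Qed.

Lemma det_line (x y : 'M[C]_n) :
  exists P : {poly C}, forall t, P.[t] = \det (x + t *: (y - x)).
Proof.
have [P PE] := mx_eval_line (\det generic_mx) x y; exists P => t.
rewrite PE mx_eval_det; congr (\det _); apply/matrixP=> i j.
by rewrite mxE mx_eval_gen.
Qed.

Definition vanish (Y : 'M[C]_n -> Prop) (p : poly_fun) : Prop :=
  forall x, Y x -> mx_eval p x = 0.

(** Affine subspaces have this property with d = 1, and intersecting them with
GL_n only costs the determinant along the line. *)
Definition line_dense (Y : 'M[C]_n -> Prop) : Prop :=
  forall x y, Y x -> Y y -> exists2 d : {poly C}, d != 0 &
    forall t, d.[t] != 0 -> Y (x + t *: (y - x)).

Lemma poly_nonroot (d : {poly C}) : d != 0 -> exists t, d.[t] != 0.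
Proof.
move=> d0; apply: contrapT => /forallNP H.
have := max_poly_roots (rs := [seq i%:R | i <- iota 0 (size d)]) d0.
rewrite size_map size_iota ltnn map_inj_uniq ?iota_uniq; last first.
  by move=> i j /eqP; rewrite eqr_nat => /eqP.
move=> H'; suff: false by []; apply: H' => //; apply/allP => t _.
by apply/rootP/eqP/negPn/negP; exact: H.
Qed.

(** Restrict to the line joining a point where p does not vanish to a point
where q does not: a univariate polynomial has finitely many roots. *)
Lemma line_dense_mul Y p q : line_dense Y ->
  vanish Y (p * q) -> vanish Y p \/ vanish Y q.
Proof.
move=> lY pq0; apply: contrapT => /not_orP [/existsNP [x /not_implyP [Yx px]]].
move=> /existsNP [y /not_implyP [Yy qy]].
have [d d0 dY] := lY x y Yx Yy.
have [P PE] := mx_eval_line p x y; have [Q QE] := mx_eval_line q x y.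
have P0 : P != 0.
  apply/eqP => P0; apply: px; have := PE 0.
  by rewrite P0 horner0 scale0r addr0.
have Q0 : Q != 0.
  apply/eqP => Q0; apply: qy; have := QE 1.
  by rewrite Q0 horner0 scale1r addrC subrK.
have [t] : exists t, (d * (P * Q)).[t] != 0 by apply: poly_nonroot; rewrite !mulf_neq0.
rewrite !hornerM mulf_eq0 negb_or => /andP [/dY Yt /eqP []].
by rewrite PE QE -(pq0 _ Yt) /mx_eval mevalM.
Qed.

Lemma vanish_prime Y : (exists x, Y x) ->
  (forall p q, vanish Y (p * q) -> vanish Y p \/ vanish Y q) ->
  prime_ideal (vanish Y).
Proof.
move=> [x Yx] Yp; split=> //.
- move=> p q p0 q0 z Yz.
  by rewrite /mx_eval mevalD [X in X + _]p0 // [X in _ + X]q0 ?addr0.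
- by move=> p q q0 z Yz; rewrite /mx_eval mevalM [X in _ * X]q0 ?mulr0.
- by move=> /(_ x Yx) /eqP; rewrite /mx_eval meval1 oner_eq0.
Qed.

End MatrixPolynomials.

(** * Flags as cosets of the Borel subgroup *)
Section FlagsOfMatrices.
Variables (R : realType) (n : nat).
Local Notation C := R[i].
Implicit Types (g h b : 'M[C]_n) (v x : 'cV[C]_n) (V : Defs.family R n).

Definition flag_of g : Defs.family R n := flag_act g (coordinate_flag R 1%g).

Lemma mem_coordinate_flag (w : 'S_n) (k : 'I_n.+1) v :
  v \in coordinate_flag R w k <-> forall j : 'I_n, (k <= j)%N -> v (w j) ord0 = 0.
Proof.
rewrite ffunE; set X := [seq _ | j <- _ & _]; split=> [vX j kj|v0].
  rewrite (@coord_span _ _ _ (in_tuple X) v vX) summxE big1 // => i _.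
  have : X`_i \in X by apply: mem_nth.
  case/mapP=> l; rewrite mem_filter => /andP [lk _] ->.
  rewrite !mxE eqxx andbT (inj_eq perm_inj).
  case: eqVneq => [jl|_]; last by rewrite mulr0.
  by move: lk; rewrite -jl ltnNge kj.
have -> : v = \sum_j v (w j) ord0 *: delta_mx (w j) ord0.
  apply/colP => i; rewrite summxE (bigD1 (w^-1 i)%g) //= permKV !mxE !eqxx mulr1.
  rewrite big1 ?addr0 // => j ji; rewrite !mxE eqxx andbT.
  by case: (i =P w j) ji => [->|_ _]; rewrite ?permK ?eqxx ?mulr0.
apply: rpred_sum => j _; case: (ltnP j k) => jk; last by rewrite v0 // scale0r mem0v.
apply: rpredZ; apply: memv_span; apply/mapP; exists j => //.
by rewrite mem_filter jk mem_enum.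
Qed.

Lemma mem_flag_act g V k v : g \in unitmx ->
  (v \in flag_act g V k) = (invmx g *m v \in V k).
Proof.
move=> gU; rewrite ffunE; apply/memv_imgP/idP => [[u uV ->]|vV].
  by rewrite lfunE /= mulKmx.
by exists (invmx g *m v); rewrite // lfunE /= mulKVmx.
Qed.

Lemma mem_flag_of g (k : 'I_n.+1) v : g \in unitmx ->
  v \in flag_of g k <-> forall j : 'I_n, (k <= j)%N -> (invmx g *m v) j ord0 = 0.
Proof.
move=> gU; rewrite mem_flag_act // mem_coordinate_flag.
by split=> H j kj; have := H j kj; rewrite perm1.
Qed.

Lemma borelP b : borel b <-> b \in unitmx /\ forall i j : 'I_n, (j < i)%N -> b i j = 0.
Proof.
split=> [[bU /is_trig_mxP bT]|[bU bT]]; split=> //.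
  by move=> i j ji; have := bT j i ji; rewrite mxE.
by apply/is_trig_mxP=> i j ij; rewrite mxE bT.
Qed.

Lemma borel_trig b (i j : 'I_n) : borel b -> (j < i)%N -> b i j = 0.
Proof. by case/borelP=> _; apply. Qed.

Lemma borel_diag b i : borel b -> b i i != 0.
Proof.
case=> bU bT; move: bU; rewrite -unitmx_tr unitmxE (det_trig bT) unitfE.
by rewrite prodf_seq_neq0 => /allP /(_ i); rewrite mem_index_enum mxE => /(_ isT).
Qed.

Lemma trig_diag_borel b : (forall i j : 'I_n, (j < i)%N -> b i j = 0) ->
  (forall i, b i i != 0) -> borel b.
Proof.
move=> bT bD; apply/borelP; split=> //; rewrite -unitmx_tr unitmxE det_trig.
  by rewrite unitfE prodf_seq_neq0; apply/allP => i _; rewrite mxE bD.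
by apply/is_trig_mxP=> i j ij; rewrite mxE bT.
Qed.

Lemma borel_unit b : borel b -> b \in unitmx.
Proof. by case. Qed.

Lemma borel1 : borel (1%:M : 'M[C]_n).
Proof.
apply/borelP; split; first exact: unitmx1.
by move=> i j ji; rewrite mxE -val_eqE gtn_eqF.
Qed.

Lemma borel_mul b b' : borel b -> borel b' -> borel (b *m b').
Proof.
move=> bB bB'; apply/borelP; split; first by rewrite unitmx_mul !borel_unit.
move=> i j ji; rewrite mxE big1 // => l _; case: (ltnP l i) => li.
  by rewrite (borel_trig bB) ?mul0r.
by rewrite (borel_trig bB' (leq_trans ji li)) mulr0.
Qed.

(** Upper triangular invertible matrices preserve the position of the last
nonzero coordinate. *)
Lemma borel_mul_last b x (j : 'I_n) : borel b ->
  (forall l : 'I_n, (j < l)%N -> x l ord0 = 0) -> (b *m x) j ord0 = b j j * x j ord0.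
Proof.
move=> bB x0; rewrite mxE (bigD1 j) //= big1 ?addr0 // => l lj.
case: (ltngtP l j) => [lj'|jl|/val_inj/eqP]; last by rewrite (negPf lj).
  by rewrite (borel_trig bB) ?mul0r.
by rewrite x0 ?mulr0.
Qed.

Lemma last_nonzero x (P : pred 'I_n) j0 : P j0 -> x j0 ord0 != 0 ->
  exists j, [/\ P j, x j ord0 != 0 &
    forall l : 'I_n, (j < l)%N -> P l -> x l ord0 = 0].
Proof.
move=> Pj0 xj0; pose Q j := P j && (x j ord0 != 0).
have Qj0 : Q j0 by rewrite /Q Pj0.
case: (arg_maxnP (fun j : 'I_n => nat_of_ord j) Qj0) => j /andP [Pj xj] jmax.
exists j; split=> // l jl Pl; apply/eqP/negPn/negP => xl.
by have := jmax l; rewrite /Q Pl xl => /(_ isT) /=; rewrite leqNgt jl.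
Qed.

Lemma borel_mul_eq0 b x (k : nat) : borel b ->
  (forall j : 'I_n, (k <= j)%N -> (b *m x) j ord0 = 0) ->
  forall j : 'I_n, (k <= j)%N -> x j ord0 = 0.
Proof.
move=> bB bx0 j kj; apply/eqP/negPn/negP => xj.
have [l [kl xl lmax]] := last_nonzero (P := fun l : 'I_n => (k <= l)%N) kj xj.
have := bx0 l kl; rewrite borel_mul_last // => [/eqP|m lm].
  by rewrite mulf_eq0 (negPf xl) (negPf (borel_diag l bB)).
by apply: lmax => //; rewrite (leq_trans kl) // ltnW.
Qed.

Lemma borel_inv b : borel b -> borel (invmx b).
Proof.
move=> bB; have bU := borel_unit bB; apply/borelP; split; first by rewrite unitmx_inv.
move=> i j ji; have E : b *m col j (invmx b) = col j 1%:M.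
  by rewrite !colE mulmxA mulmxV.
have := @borel_mul_eq0 b (col j (invmx b)) j.+1 bB; rewrite E.
move=> /(_ _ i ji); rewrite mxE; apply=> l jl.
by rewrite !mxE -val_eqE gtn_eqF.
Qed.

Lemma flag_ofMr g b : g \in unitmx -> borel b -> flag_of (g *m b) = flag_of g.
Proof.
move=> gU bB; have bU := borel_unit bB; apply/ffunP => k; apply/vspaceP => v.
have gbU : g *m b \in unitmx by rewrite unitmx_mul gU.
have E : invmx (g *m b) *m v = invmx b *m (invmx g *m v).
  by apply: (can_inj (mulKmx gbU)); rewrite mulKVmx // -mulmxA !mulKVmx.
apply/idP/idP => /mem_flag_of H; apply/mem_flag_of => // j kj.
  apply: (borel_mul_eq0 (borel_inv bB)) kj => l kl; rewrite -E; exact: H.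
apply: (borel_mul_eq0 bB) kj => l kl; rewrite E mulKVmx //; exact: H.
Qed.

Lemma flag_of_inj g h : g \in unitmx -> h \in unitmx ->
  flag_of g = flag_of h -> borel (invmx g *m h).
Proof.
move=> gU hU E; apply/borelP; rewrite unitmx_mul unitmx_inv gU; split=> // i j ji.
have jn : (j.+1 < n.+1)%N by rewrite ltnS.
have: col j h \in flag_of h (Ordinal jn).
  apply/mem_flag_of => // l jl; rewrite colE mulmxA mulVmx // mul1mx !mxE.
  by rewrite -val_eqE gtn_eqF.
by rewrite -E => /(mem_flag_of _ _ gU) /(_ i ji); rewrite colE mulmxA -colE mxE.
Qed.

Lemma flag_act_coordinate b (w : 'S_n) : b \in unitmx ->
  flag_act b (coordinate_flag R w) = flag_of (col_perm w b).
Proof.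
move=> bU; have bwU : col_perm w b \in unitmx.
  by rewrite col_permE unitmx_mul bU unitmx_perm.
apply/ffunP => k; apply/vspaceP => v; rewrite mem_flag_act //.
have E j : (invmx (col_perm w b) *m v) j ord0 = (invmx b *m v) (w j) ord0.
  have -> : invmx (col_perm w b) *m v = row_perm w (invmx b *m v); last by rewrite mxE.
  apply: (can_inj (mulKmx bwU)); rewrite mulKVmx //.
  rewrite col_permE row_permE -(mulmxA b) (mulmxA (perm_mx w^-1)) -perm_mxM mulVg.
  by rewrite perm_mx1 mul1mx mulKVmx.
apply/idP/idP => [/mem_coordinate_flag H|/mem_flag_of H].
  by apply/mem_flag_of => // j kj; rewrite E H.
by apply/mem_coordinate_flag => j kj; rewrite -E H.
Qed.

Lemma dim_coordinate_flag (w : 'S_n) (k : 'I_n.+1) :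
  \dim (coordinate_flag R w k) = k.
Proof.
pose f j : 'cV[C]_n := delta_mx (w j) ord0.
have fL : free [seq f j | j <- enum 'I_n].
  apply: (basis_free (U := fullv)); rewrite basisEdim size_map -cardE card_ord.
  rewrite dimvf dim_matrix mulr1 leqnn andbT; apply/subvP => v _.
  have := (mem_coordinate_flag w ord_max v).2.
  rewrite ffunE (eq_filter (a2 := predT)) ?filter_predT; last first.
    by move=> j /=; rewrite ltn_ord.
  by apply=> j; rewrite leqNgt ltn_ord.
rewrite ffunE; have : free [seq f j | j : 'I_n <- enum 'I_n & (j < k)%N].
  pose lt_k (j : 'I_n) := (j < k)%N.
  move: fL; rewrite -(perm_free (perm_map f (permEl (perm_filterC lt_k _)))).
  by rewrite map_cat => /catl_free.
rewrite /free => /eqP ->; rewrite size_map size_filter -sum1_count big_enum_cond.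
by rewrite (big_ord_narrow (ltn_ord k : (k <= n)%N)) sum1_card card_ord.
Qed.
End FlagsOfMatrices.

(** * Schubert cells as affine spaces *)
Section Cells.
Variables (R : realType) (n : nat).
Local Notation C := R[i].
Implicit Types (g h b u : 'M[C]_n) (v x : 'cV[C]_n) (V : Defs.family R n).
Implicit Types (w : 'S_n) (T : {set 'I_n * 'I_n}).

Lemma flag_of_variety g : g \in unitmx -> flag_variety (flag_of g).
Proof.
move=> gU; split=> [k|k l kl]; last first.
  apply/subvP => v /mem_flag_of => /(_ gU) H; apply/mem_flag_of => // j lj.
  by apply: H; apply: leq_trans lj.
rewrite /flag_of /flag_act ffunE limg_dim_eq ?dim_coordinate_flag //.
apply/eqP; rewrite -subv0; apply/subvP => v; rewrite memv_cap memv_ker => /andP [_].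
rewrite lfunE memv0 /= => /eqP gv; apply/eqP.
by rewrite -(mulKmx gU v) gv mulmx0.
Qed.

(** The columns of g are vectors chosen in V_(j+1) outside V_j.  The flag
determines the last nonzero coordinate of x from the smallest V_k containing
g x, which gives at once the invertibility of g and both inclusions. *)
Lemma flag_variety_flag_of V : flag_variety V -> exists2 g, g \in unitmx & V = flag_of g.
Proof.
move=> [dimV monV].
pose lo (j : 'I_n) : 'I_n.+1 := widen_ord (leqnSn n) j.
pose hi (j : 'I_n) : 'I_n.+1 := lift ord0 j.
have [f fP] : exists f : 'I_n -> 'cV[C]_n, forall j, f j \in V (hi j) /\ f j \notin V (lo j).
  apply: (fin_all_exists (P := fun j x => x \in V (hi j) /\ x \notin V (lo j))) => j.
  have /subvPn [x xhi xlo] : ~~ (V (hi j) <= V (lo j))%VS.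
    apply/negP => /dimvS; rewrite !dimV lift0 /=; lia.
  by exists x.
pose g : 'M[C]_n := \matrix_(i, j) f j i ord0.
have gE x : g *m x = \sum_j x j ord0 *: f j.
  apply/colP => i; rewrite mxE summxE; apply: eq_bigr => j _.
  by rewrite !mxE mulrC.
have sub x (k : 'I_n.+1) : (forall j : 'I_n, (k <= j)%N -> x j ord0 = 0) -> g *m x \in V k.
  move=> x0; rewrite gE; apply: rpred_sum => j _.
  case: (leqP k j) => kj; first by rewrite x0 // scale0r mem0v.
  apply: rpredZ; apply: (subvP (monV (hi j) k _)); last by have [] := fP j.
  by rewrite lift0.
have super x (k : 'I_n.+1) : g *m x \in V k -> forall j : 'I_n, (k <= j)%N -> x j ord0 = 0.
  move=> gx j kj; apply/eqP/negPn/negP => xj.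
  have [l [kl xl lmax]] := last_nonzero (P := fun l : 'I_n => (k <= l)%N) kj xj.
  have [_ /negP []] := fP l.
  pose y : 'cV[C]_n := \col_i (if (i < l)%N then x i ord0 else 0).
  have yV : g *m y \in V (lo l).
    by apply: sub => i li; rewrite mxE ltnNge li.
  have gxV : g *m x \in V (lo l) by apply: (subvP (monV k (lo l) kl)).
  have xE : x l ord0 *: f l = g *m x - g *m y.
    rewrite !gE -sumrB (bigD1 l) //= mxE ltnn scale0r subr0 big1 ?addr0 // => i il.
    rewrite mxE; case: (ltngtP i l) => [|li|/val_inj/eqP]; rewrite ?subrr //.
      by rewrite lmax ?scale0r ?subrr // (leq_trans kl) // ltnW.
    by rewrite (negPf il).
  suff : x l ord0 *: f l \in V (lo l) by rewrite rpredZeq (negPf xl).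
  by rewrite xE rpredB.
have gU : g \in unitmx.
  rewrite -unitmx_tr -row_free_unit -kermx_eq0; apply/rowV0P => y /sub_kermxP yg.
  have gy : g *m y^T = 0 by rewrite -[g]trmxK -trmx_mul yg trmx0.
  apply: trmx_inj; apply/colP => j; rewrite trmx0 [RHS]mxE.
  by apply: (super _ ord0) => //; rewrite gy mem0v.
exists g => //; apply/ffunP => k; apply/vspaceP => v; apply/idP/idP.
  move=> vV; apply/mem_flag_of => //; apply: super; by rewrite mulKVmx.
by move=> /mem_flag_of => /(_ gU) /sub; rewrite mulKVmx.
Qed.

(** One notion for both coordinate systems: unipotent matrices supported on
inversions, and upper triangular matrices with free entries at T. *)
Definition id_off T u : Prop := forall i j, (i, j) \notin T -> u i j = (i == j)%:R.

Definition inv_set w : {set 'I_n * 'I_n} :=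
  [set t : 'I_n * 'I_n | (t.1 < t.2)%N && (w^-1%g t.2 < w^-1%g t.1)%N]%SET.

(** The factorisation B = U_w (B cap w B w^-1), obtained linearly: the entries
of b^-1 u at the inversions of w depend affinely on those of u, and the linear
part [f] is injective.  Indeed if X is supported on the inversions and b^-1 X
off them, then in each column the last nonzero entries of X and of b^-1 X are
at the same place, so both matrices vanish. *)
Lemma borel_factor w b : borel b -> exists2 u, id_off (inv_set w) u &
  forall i j, (w^-1%g j < w^-1%g i)%N -> (invmx b *m u) i j = 0.
Proof.
move=> bB; have b'B := borel_inv bB; have bU := borel_unit bB.
pose cut (X : 'M[C]_n) : 'M[C]_n :=
  \matrix_(i, j) if (i, j) \in inv_set w then X i j else 0.
pose f (X : 'M[C]_n) : 'M[C]_n := \matrix_(i, j)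
  if (i, j) \in inv_set w then (invmx b *m cut X) i j else X i j.
have cutP a X Y : cut (a *: X + Y) = a *: cut X + cut Y.
  by apply/matrixP=> i j; rewrite !mxE; case: ifP; rewrite ?mulr0 ?addr0.
have fP : linear f.
  move=> a X Y; apply/matrixP=> i j.
  rewrite [LHS]mxE [RHS]mxE [(a *: f X) i j]mxE ![f _ i j]mxE.
  by rewrite cutP mulmxDr -scalemxAr; case: ifP => _; rewrite !mxE.
pose lf := GRing.isLinear.Build _ _ _ _ f fP.
pose F : {linear 'M[C]_n -> 'M[C]_n} := HB.pack f lf.
have : lker (linfun F) == 0%VS.
  rewrite -subv0; apply/subvP => X; rewrite memv_ker lfunE memv0 /= => /eqP fX.
  have E i j : (f X) i j = 0 by rewrite fX mxE.
  have XE : cut X = X.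
    by apply/matrixP=> i j; have := E i j; rewrite !mxE; case: ifP.
  have YE i j : (i, j) \in inv_set w -> (invmx b *m X) i j = 0.
    by move=> ij; have := E i j; rewrite mxE ij XE.
  have X0 i j : (i, j) \notin inv_set w -> X i j = 0.
    by move=> ij; rewrite -XE mxE (negPf ij).
  suff Y0 : invmx b *m X = 0 by rewrite -(mulKVmx bU X) Y0 mulmx0.
  apply/matrixP => i j; rewrite [RHS]mxE; apply/eqP/negPn/negP => Yij.
  pose y := col j (invmx b *m X).
  have yi : y i ord0 != 0 by rewrite mxE.
  have [l [_ yl lmax]] := last_nonzero (P := predT) isT yi.
  have := borel_mul_last bB (fun l' (H : (l < l')%N) => lmax l' H isT).
  have -> : b *m y = col j X by rewrite /y !colE mulmxA mulKVmx.
  rewrite [LHS]mxE => Xlj.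
  have : X l j != 0 by rewrite Xlj mulf_neq0 // borel_diag.
  have [lj|/X0 ->] := boolP ((l, j) \in inv_set w); last by rewrite eqxx.
  by move: yl; rewrite mxE YE // eqxx.
move=> /lker0_lfunVK FK.
(* b^-1 (1 + X) vanishes at the inversions exactly when f X = Z there. *)
pose Z : 'M[C]_n := \matrix_(i, j) if (i, j) \in inv_set w then - invmx b i j else 0.
pose X : 'M[C]_n := (linfun F)^-1%VF Z.
have E i j : f X i j = Z i j by rewrite -(FK Z) lfunE.
have cX : cut X = X.
  by apply/matrixP=> i j; have := E i j; rewrite !mxE; case: ifP.
exists (1%:M + X) => [i j ij|i j ij].
  by rewrite mxE -[X]cX !mxE (negPf ij) addr0.
rewrite mulmxDr mulmx1 mxE; case: (ltngtP i j) => [lij|lji|/val_inj eij].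
- have ijT : (i, j) \in inv_set w by rewrite inE /= lij.
  by have := E i j; rewrite [LHS]mxE [RHS]mxE ijT cX => ->; rewrite subrr.
- rewrite (borel_trig b'B lji) add0r mxE big1 // => l _.
  case: (ltnP l i) => li; first by rewrite (borel_trig b'B li) mul0r.
  rewrite -cX mxE inE /= ltnNge (leq_trans (ltnW lji) li) mulr0 //.
by rewrite eij ltnn in ij.
Qed.

Lemma id_off_borel w u : id_off (inv_set w) u -> borel u.
Proof.
move=> uT; apply: trig_diag_borel => [i j ji|i].
  by rewrite uT ?inE /= 1?ltnNge ?(ltnW ji) // -val_eqE gtn_eqF.
by rewrite uT ?eqxx ?oner_eq0 // inE /= ltnn.
Qed.

Lemma id_off_unit w u : id_off (inv_set w) u -> u \in unitmx.
Proof. by move=> /id_off_borel /borel_unit. Qed.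

Lemma col_perm_unit w g : (col_perm w g \in unitmx) = (g \in unitmx).
Proof. by rewrite col_permE unitmx_mul unitmx_perm andbT. Qed.

Lemma schubert_cellP w V : schubert_cell R w V <->
  exists2 u, id_off (inv_set w) u & V = flag_of (col_perm w u).
Proof.
split=> [[b bB <-]|[u uT ->]]; last first.
  have uB := id_off_borel uT; exists u => //; exact/flag_act_coordinate/borel_unit.
have bU := borel_unit bB; rewrite flag_act_coordinate //.
have [u uT bu] := borel_factor w bB; exists u => //.
have uU := borel_unit (id_off_borel uT).
(* The quotient of the two matrices is b^-1 u conjugated by w. *)
have hE : col_perm w u = col_perm w b *m (invmx (col_perm w b) *m col_perm w u).
  by rewrite mulKVmx // col_perm_unit.
rewrite hE flag_ofMr ?col_perm_unit //; apply/borelP.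
rewrite unitmx_mul unitmx_inv !col_perm_unit bU uU; split=> // i j ji.
have -> : invmx (col_perm w b) *m col_perm w u = row_perm w (col_perm w (invmx b *m u)).
  apply: (can_inj (mulKmx (_ : col_perm w b \in unitmx))); first by rewrite col_perm_unit.
  rewrite mulKVmx ?col_perm_unit // row_permE !col_permE.
  rewrite -(mulmxA b) (mulmxA (perm_mx w^-1)).
  by rewrite -perm_mxM mulVg perm_mx1 mul1mx mulmxA mulKVmx.
by rewrite !mxE -[RHS](bu (w i) (w j)) ?permK // mxE.
Qed.

Lemma schubert_cell_sub w V : schubert_cell R w V -> flag_variety V.
Proof.
move=> /schubert_cellP [u uT ->]; apply: flag_of_variety.
by rewrite col_perm_unit; apply: id_off_unit uT.
Qed.

End Cells.

(** * Upper bounds on chains of irreducible sets of flags *)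
Section UpperBound.
Local Open Scope classical_set_scope.
Variables (R : realType) (n : nat).
Local Notation C := R[i].
Local Notation poly_fun := {mpoly C[n * n]}.
Local Notation zariski := (@zariski_closed R n).
Implicit Types (g h b u : 'M[C]_n) (V : Defs.family R n).
Implicit Types (w : 'S_n) (T : {set 'I_n * 'I_n}) (X A : set (Defs.family R n)).

Definition flag_preimage A g : Prop := g \in unitmx /\ A (flag_of g).

Lemma mx_eval_affine (p : poly_fun) g b :
  exists q, forall x, mx_eval q x = mx_eval p (g *m x *m b).
Proof.
exists (subst_mx (map_mx (@mpolyC _ _) g *m generic_mx R n *m map_mx (@mpolyC _ _) b) p).
move=> x; rewrite mx_eval_subst; congr (mx_eval p _).
have -> : map_mx (fun q : poly_fun => mx_eval q x) = map_mx (meval (mxvec x ord0)) by [].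
rewrite !map_mxM; congr (_ *m _ *m _).
- by apply/matrixP=> i j; rewrite !mxE; exact: mevalC.
- by apply/matrixP=> i j; rewrite [LHS]mxE -[RHS](mx_eval_gen x).
- by apply/matrixP=> i j; rewrite !mxE; exact: mevalC.
Qed.

Lemma mx_eval_mulr (p : poly_fun) b :
  exists q, forall x, mx_eval q x = mx_eval p (x *m b).
Proof.
by have [q qE] := mx_eval_affine p 1%:M b; exists q => x; rewrite qE mul1mx.
Qed.

Definition upper_set : {set 'I_n * 'I_n} := [set t : 'I_n * 'I_n | (t.1 <= t.2)%N]%SET.

Lemma borel_id_off b : borel b -> id_off (upper_set) b.
Proof.
move=> bB i j; rewrite inE -ltnNge /= => ji.
by rewrite (borel_trig bB ji) -val_eqE gtn_eqF.
Qed.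

(** With T shrinking from the whole upper triangle to nothing, these sets go
from the coset g B down to the point g. *)
Definition borel_coset g T x : Prop := exists b, [/\ borel b, id_off T b & x = g *m b].

Lemma id_off_line T b b' t : id_off T b -> id_off T b' ->
  id_off T (b + t *: (b' - b)).
Proof. by move=> bT bT' i j ij; rewrite !mxE bT // bT' // subrr mulr0 addr0. Qed.

Lemma id_off_add T b (x : C) i j : id_off T b -> (i, j) \in T ->
  id_off T (b + x *: delta_mx i j).
Proof.
move=> bT ijT k l klT; rewrite !mxE bT //.
case: (k =P i) => [ki|]; case: (l =P j) => [lj|]; rewrite ?mulr0 ?addr0 //.
by rewrite ki lj ijT in klT.
Qed.

Lemma borel_coset_prime g T : prime_ideal (vanish (borel_coset g T)).
Proof.
apply: vanish_prime.
  exists g, 1%:M; split; [exact: borel1| |by rewrite mulmx1].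
  by move=> i j _; rewrite mxE.
move=> p q; apply: line_dense_mul => _ _ [b [bB bT ->]] [b' [bB' bT' ->]].
have [d dE] := det_line b b'; exists d => [|t dt].
  apply/eqP => d0; have := borel_unit bB; rewrite unitmxE unitfE.
  by have := dE 0; rewrite scale0r addr0 d0 horner0 => <-; rewrite eqxx.
exists (b + t *: (b' - b)); split.
- apply/borelP; split; first by rewrite unitmxE unitfE -dE.
  by move=> i j ji; rewrite !mxE !borel_trig // subrr mulr0 addr0.
- exact: id_off_line.
by rewrite mulmxDr -scalemxAr mulmxBr.
Qed.

Lemma take_step (S : eqType) (s : seq S) k : uniq s -> (k < size s)%N ->
  exists t, [/\ t \in s, t \notin take k s & take k.+1 s = rcons (take k s) t].
Proof.
move=> us ks; have [x0 _] : exists x0, x0 \in s.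
  by case: s ks {us} => // x0 s _; exists x0; rewrite mem_head.
exists (nth x0 s k); split; [exact: mem_nth| |exact: take_nth].
move: us; rewrite -{1}(cat_take_drop k s) (drop_nth x0 ks) cat_uniq /=.
by case/and3P=> _ /norP [].
Qed.

Lemma borel_coset_chain g : g \in unitmx ->
  prime_chain (vanish (borel_coset g upper_set)) #|upper_set|.
Proof.
move=> gU; pose s := enum upper_set; pose T k := [set t in take k s]%SET.
have Ts : T (size s) = upper_set.
  by apply/setP => t; rewrite [LHS]inE take_size mem_enum.
have H k : (k <= size s)%N -> prime_chain (vanish (borel_coset g (T k))) k.
  elim: k => [|k IHk] ks; first exact/PrimeChain0/borel_coset_prime.
  have [[i j] [ijs ijk sk]] := take_step (enum_uniq _) ks.
  have ij : (i <= j)%N by move: ijs; rewrite mem_enum inE.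
  have ijT : (i, j) \in T k.+1 by rewrite inE sk mem_rcons mem_head.
  have sub : {subset T k <= T k.+1}.
    by move=> t; rewrite !inE sk mem_rcons inE orbC => ->.
  have [q qE] : exists q, forall x, mx_eval q x = (invmx g *m x) i j - (i == j)%:R.
    have [q qE] := mx_eval_affine (generic_mx R n i j) (invmx g) 1%:M.
    exists (q - (i == j)%:R%:MP) => x; rewrite -(mulmx1 (invmx g *m x)).
    by rewrite -(mx_eval_gen (invmx g *m x *m 1%:M)) -qE /mx_eval mevalB mevalC.
  apply: (PrimeChainS (f := q) (IHk (ltnW ks))); first exact: borel_coset_prime.
  - move=> p pJ _ [b [bB bT ->]]; apply: pJ; exists b; split=> //.
    by move=> i' j' ijT'; apply: bT; apply: contra ijT'; apply: sub.
  - move=> _ [b [bB bT ->]]; rewrite qE mulKmx // bT ?subrr //.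
    by rewrite inE.
  move=> /(_ (g *m (1%:M + 1 *: delta_mx i j))) q0.
  have : mx_eval q (g *m (1%:M + 1 *: delta_mx i j)) = 1.
    by rewrite qE mulKmx // !mxE !eqxx mulr1 addrAC subrr add0r.
  rewrite q0; first by move/eqP; rewrite eq_sym oner_eq0.
  exists (1%:M + 1 *: delta_mx i j); split=> //; last first.
    by apply: id_off_add => // k' l _; rewrite mxE.
  apply: trig_diag_borel => [k' l lk|k'].
    rewrite !mxE -val_eqE gtn_eqF // add0r mul1r.
    case: (k' =P i) => [ki|//]; case: (l =P j) => [lj|//].
    by move: lk; rewrite ki lj ltnNge ij.
  rewrite !mxE eqxx mul1r -natrD pnatr_eq0.
  by case: (_ && _).
by rewrite cardE -/s -Ts; apply: H.
Qed.

Lemma flag_preimageMr A g b : borel b -> flag_preimage A g -> flag_preimage A (g *m b).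
Proof.
move=> bB [gU Ag]; split; first by rewrite unitmx_mul gU borel_unit.
by rewrite flag_ofMr.
Qed.

(** Asking p to vanish on whole fibres g B makes its zero locus a set of flags;
the equations of this set are the translates of p under B. *)
Lemma saturation_closed (p : poly_fun) : exists2 Z : set (Defs.family R n),
  zariski_closed Z & forall g, g \in unitmx ->
    (Z (flag_of g) <-> forall b, borel b -> mx_eval p (g *m b) = 0).
Proof.
pose Z : set (Defs.family R n) := fun V => forall g, g \in unitmx -> V = flag_of g ->
  forall b, borel b -> mx_eval p (g *m b) = 0.
have ZE g : g \in unitmx ->
    (Z (flag_of g) <-> forall b, borel b -> mx_eval p (g *m b) = 0).
  move=> gU; split=> [/(_ g gU erefl) //|H h hU E b bB].
  have cB := flag_of_inj gU hU E.
  by rewrite -(mulKVmx gU h) -mulmxA; apply/H/borel_mul.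
exists Z => //.
exists (fun q => exists2 b, borel b & forall x, mx_eval q x = mx_eval p (x *m b)).
move=> g gU; apply: (iff_trans (ZE g gU)); split=> [H q [b bB ->]|H b bB].
  exact: H.
by have [q qE] := mx_eval_mulr p b; rewrite -qE; apply: H; exists b.
Qed.

(** If p q vanishes on the preimage of A, then over each point of A one of p, q
vanishes on the whole fibre, since the fibre is irreducible; so A is covered by
the closed loci of [saturation_closed] for p and for q. *)
Lemma flag_preimage_prime A : irreducible_set zariski A ->
  (forall V, A V -> flag_variety V) -> prime_ideal (vanish (flag_preimage A)).
Proof.
move=> [[V AV] irrA] AF; apply: vanish_prime.
  by have [g gU E] := flag_variety_flag_of (AF V AV); exists g; split; rewrite -?E.
move=> p q pq0; have [Zp Zpc ZpE] := saturation_closed p.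
have [Zq Zqc ZqE] := saturation_closed q.
have AE : A = (A `&` Zp) `|` (A `&` Zq).
  apply/seteqP; split=> [U AU|U [] []] //.
  have [g gU E] := flag_variety_flag_of (AF U AU).
  have gA : flag_preimage A g by split=> //; rewrite -E.
  have pqY : vanish (borel_coset g upper_set) (p * q).
    by move=> _ [b [bB _ ->]]; apply/pq0/flag_preimageMr.
  have [p0|q0] := prime_idealP (borel_coset_prime g upper_set) pqY;
    [left|right]; split=> //.
    by rewrite E; apply/ZpE => // b bB; apply: p0; exists b; split=> //; apply: borel_id_off.
  by rewrite E; apply/ZqE => // b bB; apply: q0; exists b; split=> //; apply: borel_id_off.
have [A1|A1] := irrA _ _ (ex_intro2 _ _ Zp Zpc erefl) (ex_intro2 _ _ Zq Zqc erefl) AE.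
  left=> g [gU Ag]; have [] : (A `&` Zp) (flag_of g) by rewrite -A1.
  by move=> _ /ZpE => /(_ gU _ (borel1 R n)); rewrite mulmx1.
right=> g [gU Ag]; have [] : (A `&` Zq) (flag_of g) by rewrite -A1.
by move=> _ /ZqE => /(_ gU _ (borel1 R n)); rewrite mulmx1.
Qed.

(** Chain of primes: first dim B steps inside a coset over a point of the
smallest set, then one step for each set of the chain. *)
Theorem irreducible_chain_bound D (phi : {lrmorphism poly_fun -> {mpoly C[D]}}) X e :
  (forall V, X V -> flag_variety V) ->
  (forall p, phi p = 0 -> vanish (flag_preimage X) p) ->
  irreducible_chain zariski X e -> (e + #|upper_set| <= D)%N.
Proof.
move=> XF phiX [Z [Zirr Zlt]].
have ZX i : (i <= e)%N -> forall V, Z i V -> X V.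
  by move=> ie V; have [[F Fc ->] _] := Zirr i ie; case.
have H i : (i <= e)%N -> prime_chain (vanish (flag_preimage (Z i))) (i + #|upper_set|).
  elim: i => [|i IHi] ie.
    have [_ irr0] := Zirr 0 ie; have [[V ZV] _] := irr0.
    have [g gU E] := flag_variety_flag_of (XF V (ZX 0 ie V ZV)).
    apply: (prime_chainW (borel_coset_chain gU)).
      by apply: flag_preimage_prime => // U /(ZX 0 ie) /XF.
    move=> p p0 _ [b [bB _ ->]]; apply/p0/flag_preimageMr => //.
    by split=> //; rewrite -E.
  have [_ irrS] := Zirr i.+1 ie; have [[F [S SF] FE] _] := Zirr i (ltnW ie).
  have [sub nsub] := Zlt i ie.
  have [V [VS Vi]] : exists V, Z i.+1 V /\ ~ Z i V.
    apply: contrapT => /forallNP N; apply: nsub => V VS.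
    by apply: contrapT => Vi; apply: (N V).
  have [g gU E] := flag_variety_flag_of (XF V (ZX _ ie V VS)).
  have [p /not_implyP [Sp pg]] : exists p, ~ (S p -> mx_eval p g = 0).
    apply/existsNP => Sg; apply: Vi; rewrite FE; split; first exact: (ZX _ ie).
    by rewrite E; apply/SF.
  apply: (PrimeChainS (f := p) (IHi (ltnW ie))).
  - by apply: flag_preimage_prime => // U /(ZX _ ie) /XF.
  - by move=> q q0 h [hU Zh]; apply: q0; split=> //; apply: sub.
  - by move=> h [hU]; rewrite FE => -[_ /SF]; apply.
  - by move=> p0; apply: pg; apply: p0; split; rewrite -?E.
apply: (prime_chain_le (phi := phi)) (H e (leqnn e)) => p /phiX pX h [hU Zh].
by apply: pX; split=> //; apply: (ZX e).
Qed.

End UpperBound.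

(** * Dimensions of the Schubert cells and of the flag variety *)
Section Dimensions.
Local Open Scope classical_set_scope.
Variables (R : realType) (n : nat).
Local Notation C := R[i].
Local Notation poly_fun := {mpoly C[n * n]}.
Local Notation zariski := (@zariski_closed R n).
Implicit Types (g h b u : 'M[C]_n) (V : Defs.family R n).
Implicit Types (w : 'S_n) (T : {set 'I_n * 'I_n}) (X A : set (Defs.family R n)).

Definition generic_id_off T D (e : 'I_#|T| -> 'I_D) : 'M[{mpoly C[D]}]_n :=
  \matrix_(i, j) if [pick k | enum_val k == (i, j)] is Some k then 'X_(e k)
                 else (i == j)%:R.

Lemma meval_generic_id_off T D (e : 'I_#|T| -> 'I_D) v u : id_off T u ->
  (forall k, v (e k) = u (enum_val k).1 (enum_val k).2) ->
  map_mx (meval v) (generic_id_off e) = u.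
Proof.
move=> uT ve; apply/matrixP => i j; rewrite !mxE.
case: pickP => [k /eqP kE|noij]; first by rewrite mevalXU ve kE.
rewrite uT ?rmorph_nat //; apply/negP => ijT.
by have := noij (enum_rank_in ijT (i, j)); rewrite enum_rankK_in ?eqxx.
Qed.

(** Here (u, b) |-> u w b parametrises the preimage of the cell. *)
Lemma schubert_cell_bound w e : irreducible_chain zariski (schubert_cell R w) e ->
  (e <= #|inv_set w|)%N.
Proof.
pose h : 'M[{mpoly C[#|inv_set w| + #|upper_set n|]}]_n :=
  col_perm w (generic_id_off (@lshift _ _)) *m generic_id_off (@rshift _ _).
move=> chain; rewrite -(leq_add2r #|upper_set n|).
apply: (irreducible_chain_bound (phi := subst_mx h)) chain => [V|p p0 g [gU]].
  exact: schubert_cell_sub.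
move=> /schubert_cellP [u uT E].
have uU : col_perm w u \in unitmx by rewrite col_perm_unit (id_off_unit uT).
have bB := flag_of_inj uU gU (esym E); set b := _ *m g in bB.
pose v (k : 'I_(#|inv_set w| + #|upper_set n|)) := match fintype.split k with
  | inl k => u (enum_val k).1 (enum_val k).2
  | inr k => b (enum_val k).1 (enum_val k).2 end.
have <- : map_mx (meval v) h = g.
  rewrite map_mxM map_col_perm (meval_generic_id_off uT) => [|k]; last first.
    by rewrite /v (unsplitK (inl k)).
  rewrite (meval_generic_id_off (borel_id_off bB)) => [|k]; first exact: mulKVmx.
  by rewrite /v (unsplitK (inr k)).
by rewrite -meval_subst_mx p0 meval0.
Qed.

(** Besides having the right value on the parametrisation of the cell, p has a
zero locus that is a union of fibres, so that it defines a closed set of flags. *)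
Definition cell_coordinate w (i j : 'I_n) (p : poly_fun) : Prop :=
  (forall u, id_off (inv_set w) u -> mx_eval p (col_perm w u) = u i j) /\
  (forall g b, borel b -> mx_eval p g = 0 -> mx_eval p (g *m b) = 0).

Lemma inv_set_neq w i j : (i, j) \in inv_set w -> (i == j) = false.
Proof. by rewrite inE /= -val_eqE => /andP [ij _]; rewrite ltn_eqF. Qed.

(** Let k be such that w sends k to j.  The minor of the first k columns of g on the
rows w(1), .., w(k-1), i is taken here as the determinant of the n x n matrix
[M g], completed by columns of the identity.  At g = u w this matrix is lower
triangular, with all diagonal entries equal to 1 except for u_ij in place k. *)
Lemma cell_coordinate_exists w i j : (i, j) \in inv_set w ->
  exists p, cell_coordinate w i j p.
Proof.
rewrite inE /= => /andP [ij ji]; set k := (w^-1%g j) in ji.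
pose s : 'S_n := (tperm k (w^-1%g i) * w)%g.
pose M g : 'M[C]_n := \matrix_(a, c) if (c <= k)%N then g (s a) c else (a == c)%:R.
pose P : 'M[poly_fun]_n :=
  \matrix_(a, c) if (c <= k)%N then generic_mx R n (s a) c else (a == c)%:R.
pose p := \det P.
have pE g : mx_eval p g = \det (M g).
  rewrite mx_eval_det; congr (\det _); apply/matrixP => a c.
  rewrite !mxE; case: ifP => _; first by rewrite -[RHS]mx_eval_gen !mxE.
  by rewrite /mx_eval rmorph_nat.
have slt (a : 'I_n) : (a < k)%N -> s a = w a.
  move=> ak; rewrite permM tpermD //; first by rewrite -val_eqE gtn_eqF.
  by rewrite -val_eqE gtn_eqF // (ltn_trans ak).
exists p; split=> [u uT|g b bB p0].
  have uw (a c : 'I_n) : (a < c)%N -> u (w a) (w c) = 0.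
    move=> ac; rewrite uT ?(inj_eq perm_inj) -?val_eqE ?ltn_eqF //.
    by rewrite inE /= !permK (ltnNge c) (ltnW ac) andbF.
  rewrite pE det_trig; last first.
    apply/is_trig_mxP => a c ac; rewrite !mxE; case: leqP => ck.
      by rewrite slt ?uw // (leq_trans ac).
    by rewrite -val_eqE ltn_eqF.
  rewrite (bigD1 k) //= big1 => [|c ck]; rewrite !mxE.
    by rewrite leqnn mulr1 permM tpermL permKV /k permKV.
  case: ltngtP => [cltk|kc|/val_inj ek]; rewrite ?eqxx //.
    by rewrite slt // uT ?eqxx // inE ltnn.
  by rewrite ek eqxx in ck.
pose B : 'M[C]_n := \matrix_(a, c) if (c <= k)%N then b a c else (a == c)%:R.
rewrite pE; have -> : M (g *m b) = M g *m B; last first.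
  by rewrite det_mulmx -pE p0 mul0r.
apply/matrixP => a c; rewrite [LHS]mxE [RHS]mxE; case: (leqP c k) => ck.
  rewrite mxE; apply: eq_bigr => l _; rewrite !mxE ck; case: (leqP l k) => // kl.
  by rewrite (borel_trig bB) ?mulr0 // (leq_ltn_trans ck).
rewrite (bigD1 c) //= big1 => [|l lc]; rewrite !mxE (leqNgt c) ck /= ?eqxx ?mulr1 ?addr0 //.
by rewrite (negPf lc) mulr0.
Qed.

(** Two closed sets missing a point of the image each have an equation that
does not vanish on Y; neither does the product of these equations, so they do
not cover the image. *)
Lemma line_dense_irreducible (Y : 'M[C]_n -> Prop) :
  (exists x, Y x) -> (forall x, Y x -> x \in unitmx) -> line_dense Y ->
  irreducible_set zariski (fun V => exists2 x, Y x & V = flag_of x).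
Proof.
move=> [x Yx] YU lY; split; first by exists (flag_of x), x.
move=> _ _ [Z1 [S1 Z1E] ->] [Z2 [S2 Z2E] ->]; set A := (X in X = _ `|` _) => AE.
apply: contrapT => /not_orP [N1 N2].
have ex Z (S : set poly_fun) : (forall g, g \in unitmx -> 
    (Z (flag_act g (coordinate_flag R 1%g)) <-> forall p, S p -> mx_eval p g = 0)) ->
    A <> A `&` Z -> exists2 p, S p & ~ vanish Y p.
  move=> ZE AZ; apply: contrapT => N; apply: AZ; apply/seteqP; split=> [V AV|V []//].
  split=> //; case: AV => y Yy ->; apply/ZE; first exact: YU.
  move=> p Sp; apply: contrapT => py; apply: N; exists p => // /(_ y Yy).
  exact: py.
have [p S1p pY] := ex _ _ Z1E N1; have [q S2q qY] := ex _ _ Z2E N2.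
have [|//|//] := line_dense_mul (p := p) (q := q) lY.
move=> y Yy; have : A (flag_of y) by exists y.
rewrite AE /mx_eval mevalM => -[[_ /(Z1E _ (YU _ Yy))]|[_ /(Z2E _ (YU _ Yy))]].
  by move=> /(_ p S1p); rewrite /mx_eval => ->; rewrite mul0r.
by move=> /(_ q S2q); rewrite /mx_eval => ->; rewrite mulr0.
Qed.

(** The chain frees the coordinates of the cell one after the other. *)
Lemma schubert_cell_chain w :
  irreducible_chain zariski (schubert_cell R w) #|inv_set w|.
Proof.
pose s := enum (inv_set w); pose T k := [set t in take k s]%SET.
have TS k : T k \subset inv_set w.
  by apply/fintype.subsetP => t; rewrite inE => /mem_take; rewrite mem_enum.
have id_offS (T1 T2 : {set 'I_n * 'I_n}) u : T1 \subset T2 -> id_off T1 u -> id_off T2 u.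
  by move=> /fintype.subsetP sT uT i j ij; apply: uT; apply: contra ij; apply: sT.
pose Z k : set (Defs.family R n) := fun V =>
  exists2 x, (exists2 u, id_off (T k) u & x = col_perm w u) & V = flag_of x.
have ZU k (x : 'M[C]_n) : (exists2 u, id_off (T k) u & x = col_perm w u) -> x \in unitmx.
  by move=> [u uT ->]; rewrite col_perm_unit (id_off_unit (id_offS _ _ _ (TS k) uT)).
exists Z; rewrite cardE -/s; split=> k ks.
  split; last first.
    apply: line_dense_irreducible.
    - exists (col_perm w 1%:M), 1%:M => // i j _; by rewrite mxE.
    - exact: ZU.
    move=> _ _ [u uT ->] [u' uT' ->]; exists 1; first exact: oner_neq0.
    move=> t _; exists (u + t *: (u' - u)); first exact: id_off_line.
    by apply/matrixP => i j; rewrite !mxE.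
  pose S p := exists i j,
    [/\ (i, j) \in inv_set w, (i, j) \notin T k & cell_coordinate w i j p].
  pose F : set (Defs.family R n) := fun V => forall g, g \in unitmx -> V = flag_of g ->
    forall p, S p -> mx_eval p g = 0.
  have FE g : g \in unitmx -> (F (flag_of g) <-> forall p, S p -> mx_eval p g = 0).
    move=> gU; split=> [/(_ g gU erefl) //|H h hU E p Sp].
    rewrite -(mulKVmx gU h); have [i [j [_ _ [_]]]] := Sp; apply; last exact: H.
    exact: flag_of_inj.
  exists F; first by exists S.
  apply/seteqP; split=> V.
    move=> [_ [u uT ->] ->]; have uw := id_offS _ _ _ (TS k) uT.
    split; first by apply/schubert_cellP; exists u.
    apply/FE; first by rewrite col_perm_unit (id_off_unit uw).
    by move=> p [i [j [ijw ijT [pE _]]]]; rewrite pE // uT // (inv_set_neq ijw).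
  move=> [/schubert_cellP [u uw ->]] /FE.
  rewrite col_perm_unit (id_off_unit uw) => /(_ isT) H.
  exists (col_perm w u) => //; exists u => // i j ijT.
  have [ijw|ijw] := boolP ((i, j) \in inv_set w); last exact: uw.
  have [p pE] := cell_coordinate_exists ijw.
  by rewrite -pE.1 // H ?(inv_set_neq ijw) //; exists i, j.
have [[i j] [ijs ijk sk]] := take_step (enum_uniq _) ks.
have Tsub : T k \subset T k.+1.
  by apply/fintype.subsetP => t; rewrite !inE sk mem_rcons inE orbC => ->.
split=> [V [_ [u uT ->] ->]|ZZ].
  by exists (col_perm w u) => //; exists u => //; apply: id_offS uT.
have [p pE] : exists p, cell_coordinate w i j p.
  by apply: cell_coordinate_exists; rewrite -mem_enum.
have ijne : (i == j) = false by apply: (@inv_set_neq w); rewrite -mem_enum.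
pose u : 'M[C]_n := 1%:M + 1 *: delta_mx i j.
have uT : id_off (T k.+1) u.
  apply: id_off_add; first by move=> i' j' _; rewrite mxE.
  by rewrite inE sk mem_rcons mem_head.
have [_ [u' uT' ->] E] := ZZ _ (ex_intro2 _ _ _ (ex_intro2 _ _ u uT erefl) erefl).
have U' := ZU k _ (ex_intro2 _ _ u' uT' erefl).
have U1 := ZU k.+1 _ (ex_intro2 _ _ u uT erefl).
have : mx_eval p (col_perm w u) = 0.
  rewrite -(mulKVmx U' (col_perm w u)); apply: pE.2; first exact: flag_of_inj.
  by rewrite pE.1 ?uT' ?inE ?ijne //; apply: id_offS uT'.
rewrite pE.1; last by apply: id_offS uT.
by rewrite !mxE !eqxx ijne mulr1 add0r => /eqP; rewrite oner_eq0.
Qed.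

(** Closures of irreducible sets are irreducible, and a relatively closed
subset of X is recovered from its closure by intersecting with X. *)
Lemma irreducible_chain_sub X X' e : (forall V, X V -> X' V) ->
  irreducible_chain zariski X e -> irreducible_chain zariski X' e.
Proof.
move=> XX' [Z [Zirr Zlt]].
pose cl A : set (Defs.family R n) := fun V => forall F, zariski F -> A `<=` F -> F V.
have cl_sub A : A `<=` cl A by move=> V AV F _; apply.
have cl_closed A : zariski (cl A).
  exists (fun p => exists F S, [/\ A `<=` F, forall g, g \in unitmx ->
      (F (flag_act g (coordinate_flag R 1%g)) <-> forall q, S q -> mx_eval q g = 0) & S p]).
  move=> g gU; split=> [H p [F [S [AF FE Sp]]]|H F [S FE] AF].
    by move: p Sp; apply/(FE g gU); apply: H; [exists S|].
  by apply/(FE g gU) => p Sp; apply: H; exists F, S.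
exists (fun i => X' `&` cl (Z i)); split=> i ie.
  have [[W Wc WE] [[V ZV] irr]] := Zirr i ie.
  have ZX' : Z i `<=` X' by move=> U; rewrite WE => -[/XX'].
  split; first by exists (cl (Z i)).
  split; first by exists V; split; [exact: ZX'|exact: cl_sub].
  move=> _ _ [W1 W1c ->] [W2 W2c ->] E.
  have [|||E1|E1] := irr (Z i `&` W1) (Z i `&` W2); [by exists W1|by exists W2| | |].
  - apply/seteqP; split=> [U ZU|U [] []] //.
    have : (X' `&` cl (Z i)) U by split; [exact: ZX'|exact: cl_sub].
    by rewrite E => -[[_]|[_]]; [left|right].
  - left; apply/seteqP; split=> [U [XU cU]|U []//]; split=> //.
    by apply: cU => // U'; rewrite E1 => -[].
  - right; apply/seteqP; split=> [U [XU cU]|U []//]; split=> //.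
    by apply: cU => // U'; rewrite E1 => -[].
have [sub nsub] := Zlt i ie; split=> [V [XV cV]|N].
  split=> // F Fc ZF; apply: cV => // U /sub; exact: ZF.
apply: nsub => V ZV; have [[W Wc WE] _] := Zirr i (ltnW ie).
have [[W' W'c WE'] _] := Zirr i.+1 ie.
have XV : X V by move: ZV; rewrite WE' => -[].
have [_ cV] : (X' `&` cl (Z i)) V by apply: N; split; [exact: XX'|exact: cl_sub].
by rewrite WE; split=> //; apply: cV => // U; rewrite WE => -[].
Qed.

Lemma krull_dim_schubert_cell w : krull_dim zariski (schubert_cell R w) #|inv_set w|.
Proof. split; [exact: schubert_cell_chain | exact: schubert_cell_bound]. Qed.

Definition longest : 'S_n := perm rev_ord_inj.

Lemma inv_set_longest : inv_set longest = [set t : 'I_n * 'I_n | (t.1 < t.2)%N]%SET.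
Proof.
have inv c : (longest^-1)%g c = rev_ord c.
  by apply: (@perm_inj _ longest); rewrite permKV permE rev_ordK.
apply/setP => -[a b]; rewrite !inE !inv /=; have := ltn_ord a; have := ltn_ord b; lia.
Qed.

Lemma card_inv_longest : (#|inv_set longest| + #|upper_set n| = n * n)%N.
Proof.
pose f (t : 'I_n * 'I_n) := (t.2, t.1).
have fI : injective f by move=> [a b] [c d] [-> ->].
rewrite -(card_imset _ fI) addnC -[RHS](_ : #|{: 'I_n * 'I_n}| = _)%N; last first.
  by rewrite card_prod card_ord.
rewrite -(cardsC (upper_set n)) inv_set_longest; congr (_ + _)%N.
apply: eq_card => -[a b]; rewrite !inE -ltnNge /=; apply/imsetP/idP => [[[c d]]|ba].
  by rewrite inE => /= cd [-> ->].
by exists (b, a); rewrite ?inE.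
Qed.

Lemma krull_dim_flag_variety : krull_dim zariski (@flag_variety R n) #|inv_set longest|.
Proof.
split.
  by apply: (irreducible_chain_sub _ (schubert_cell_chain longest)) => V /schubert_cell_sub.
move=> e chain; rewrite -(leq_add2r #|upper_set n|) card_inv_longest.
apply: (irreducible_chain_bound (phi := idfun) _ _ chain) => //= p -> g _.
by rewrite /mx_eval meval0.
Qed.

End Dimensions.

(** * Counting non-inversions with pillars *)
Section PillarCount.
Local Open Scope nat_scope.
Variable n : nat.
Implicit Types (w f : 'S_n) (a b c : 'I_n).

(** Discrete intermediate value principle. *)
Lemma crossing (P : pred 'I_n) a b : a < b -> P a -> ~~ P b ->
  exists c c' : 'I_n, [/\ c' = c.+1 :> nat, a <= c, c' <= b, P c & ~~ P c'].
Proof.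
elim: {b}(nat_of_ord b) {-2}b (erefl (nat_of_ord b)) => [|k IHk] b bk; first by rewrite bk.
move=> ab Pa Pb; have kn : k < n by rewrite -[k.+1]bk in IHk *; have := ltn_ord b; lia.
pose d := Ordinal kn.
have [Pd|Pd] := boolP (P d); first by exists d, b; split => //=; rewrite -ltnS -bk.
have ad : a < d.
  rewrite ltn_neqAle -ltnS -[d.+1]/(k.+1) -bk ab andbT.
  by apply/eqP => /val_inj ad; rewrite -ad Pa in Pd.
have [c [c' [e1 e2 e3 e4 e5]]] := IHk d erefl ad Pa Pd.
by exists c, c'; split=> //; rewrite (leq_trans e3) // bk leqnSn.
Qed.

Lemma rank_entry_row w a j : rank_entry w a.+1 j = rank_entry w a j + (w a < j).
Proof.
rewrite /rank_entry (cardsD1 a) inE ltnSn /= addnC; congr (_ + _).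
by apply: eq_card => k; rewrite !inE andbA ltnS -ltn_neqAle.
Qed.

Lemma rank_entry_col w i b : rank_entry w i b.+1 = rank_entry w i b + (w^-1%g b < i).
Proof.
rewrite /rank_entry (cardsD1 (w^-1%g b)) inE permKV ltnSn andbT addnC; congr (_ + _).
apply: eq_card => k; rewrite !inE andbCA; congr (_ && _).
by rewrite ltnS -(inj_eq (@perm_inj _ w)) permKV -ltn_neqAle.
Qed.

Lemma is_pillarP w a a' b b' : a' = a.+1 :> nat -> b' = b.+1 :> nat ->
  is_pillar w a.+1 b.+1 = [&& w a <= b, b < w a', w^-1%g b <= a & a < w^-1%g b'].
Proof.
move=> ea eb; have := ltn_ord a'; have := ltn_ord b'.
have := rank_entry_row w a b.+1; have := rank_entry_row w a' b.+1.
have := rank_entry_col w a.+1 b; have := rank_entry_col w a.+1 b'.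
rewrite /is_pillar ea eb /=.
move: (w a) (w a') (w^-1%g b) (w^-1%g b') (rank_entry _ _ _) (rank_entry _ _ _).
move: (rank_entry _ _ _) (rank_entry _ _ _) (rank_entry _ _ _).
lia.
Qed.

Lemma is_pillar_ord w p q : is_pillar w p q -> exists a a' b b',
  [/\ a' = a.+1 :> nat, b' = b.+1 :> nat, p = a.+1 & q = b.+1].
Proof.
case/and3P => p1 q1 _; have a1 : p.-1 < n by lia.
have a2 : p < n by lia.
have b1 : q.-1 < n by lia.
have b2 : q < n by lia.
by exists (Ordinal a1), (Ordinal a2), (Ordinal b1), (Ordinal b2); split=> /=; lia.
Qed.

Lemma crossing_values f a b : a < b -> f a < f b ->
  (forall c, a < c -> c < b -> f a < f c -> f b <= f c) ->
  exists c c' : 'I_n, [/\ c' = c.+1 :> nat, a <= c, c' <= b, f c <= f a & f b <= f c'].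
Proof.
move=> ab fab gap.
have [|c [c' [e ac cb fc]]] := crossing (P := fun c => f c <= f a) ab (leqnn _).
  by rewrite -ltnNge.
rewrite -ltnNge => fc'; exists c, c'; split=> //.
case: (ltngtP c' b) => [c'b|//|/val_inj -> //]; last by rewrite ltnNge cb.
by apply: gap => //; rewrite e ltnS.
Qed.

(** One may assume that no dot lies strictly inside the box spanned by the two
dots a and b, by shrinking the box otherwise.  Then some row
with w <= w a is followed by a row with w >= w b; this place and the analogous
one for columns determine a pillar. *)
Lemma pillar_between w a b : a < b -> w a < w b ->
  exists p q, [/\ is_pillar w p q, a < p, p <= b, w a < q & q <= w b].
Proof.
have [m] := ubnP ((b - a) + (w b - w a)); elim: m => // m IHm in a b * => lem ab wab.
case: (pickP (fun c : 'I_n => [&& a < c, c < b, w a < w c & w c < w b])) => [c|gap].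
  case/and4P=> ac cb wac wcb; have [|p [q [pq ap pc aq qc]]] := IHm a c _ ac wac.
    by lia.
  by exists p, q; split=> //; lia.
have [c [c' [ec ac cb wc wc']]] : exists c c' : 'I_n,
    [/\ c' = c.+1 :> nat, a <= c, c' <= b, w c <= w a & w b <= w c'].
  apply: crossing_values => // c ac cb wac; rewrite leqNgt; apply/negP => wcb.
  by have := gap c; rewrite ac cb wac wcb.
have [d [d' [ed ad db vd vd']]] : exists d d' : 'I_n,
    [/\ d' = d.+1 :> nat, w a <= d, d' <= w b, w^-1%g d <= w^-1%g (w a) &
        w^-1%g (w b) <= w^-1%g d'].
  apply: crossing_values => [//||d wad dwb]; first by rewrite !permK.
  rewrite !permK => vd; rewrite leqNgt; apply/negP => vdb.
  by have := gap (w^-1%g d); rewrite vd vdb permKV wad dwb.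
rewrite !permK in vd vd'.
exists c.+1, d.+1; split; rewrite ?ltnS //; last 2 first.
- by rewrite -ec.
- by rewrite -ed.
rewrite (is_pillarP w ec ed); apply/and4P; split; lia.
Qed.

Definition lex_le (x y : nat * nat) := (x.1 < y.1) || (x.1 == y.1) && (x.2 <= y.2).

Lemma lex_le_allpairs s t : pairwise ltn s -> pairwise leq t ->
  pairwise lex_le [seq (i, j) | i <- s, j <- t].
Proof.
move=> ps pt; elim: s ps => //= i s IHs /andP [/allP si /IHs ps].
rewrite pairwise_cat ps andbT pairwise_map; apply/andP; split; last first.
  by apply: sub_pairwise pt => x y; rewrite /= /lex_le /= eqxx /= orbC => ->.
apply/allrelP => x y /mapP [j _ ->] /allpairsP [[i' j'] /= [/si ii' _ ->]].
by apply/orP; left; exact: ii'.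
Qed.

Lemma pillars_lex w : pairwise lex_le (pillars w).
Proof.
apply: pairwise_filter; apply: lex_le_allpairs.
  by rewrite -sorted_pairwise ?iota_ltn_sorted //; exact: ltn_trans.
by rewrite -sorted_pairwise ?iota_sorted //; exact: leq_trans.
Qed.

Lemma mem_pillars w p q : ((p, q) \in pillars w) = is_pillar w p q.
Proof.
rewrite mem_filter /=; apply/andb_idr => /and3P [p1 q1 _].
apply/allpairsP; exists (p, q); rewrite !mem_iota; split=> //; lia.
Qed.

Definition SE_dots w a : {set 'I_n} := [set b : 'I_n | (a < b) && (w a < w b)]%SET.

Definition first_pillar w a p q := [/\ is_pillar w p q, a < p, w a < q &
  forall p' q', is_pillar w p' q' -> a < p' -> w a < q' -> lex_le (p, q) (p', q')].

(** Let b be South-East of a.  A pillar between a and b is not above row p, so b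
is below row p.  If b were not to the right of column q, then the column
positions from w a to w b would cross row p, from dots above it to dots below
it, giving a pillar of row p to the left of (p, q) that still contains a.  This
uses that the dot of row p is a or lies to the left of a: otherwise some pillar
above row p would contain a. *)
Lemma first_pillar_SE_dots w a p q : first_pillar w a p q ->
  SE_dots w a = [set b : 'I_n | (p <= b) && (q <= w b)]%SET.
Proof.
case=> pq ap aq pqmin; apply/setP => b; rewrite !inE.
apply/andP/andP => [[ab wab]|[pb qb]]; last by split; lia.
have below c : a < c -> w a < w c -> p <= c.
  move=> ac wac; have [p' [q' [pq' ap' pc wap' _]]] := pillar_between ac wac.
  by have := pqmin _ _ pq' ap' wap'; rewrite /lex_le /=; lia.
have pb := below b ab wab; split=> //; rewrite leqNgt; apply/negP => wbq.
have [c [c' [d [d' [ec ed ep eq]]]]] := is_pillar_ord pq.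
move: pq; rewrite ep eq (is_pillarP w ec ed) => /and4P [wc wc' vd vd'].
have wca : w c <= w a.
  rewrite leqNgt; apply/negP => wac; have ac : a < c.
    rewrite ltn_neqAle -ltnS -ep ap andbT; apply/eqP => /val_inj ac.
    by rewrite ac ltnn in wac.
  by have := below c ac wac; rewrite ep ltnn.
have [||x [x' [ex ax xb vx vx']]] := crossing (P := fun x => w^-1%g x <= c) wab.
- by rewrite permK -ltnS -ep.
- by rewrite permK -ltnNge -ep.
have px : is_pillar w p x.+1.
  by rewrite ep (is_pillarP w ec ex); apply/and4P; split=> //; lia.
by have := pqmin _ _ px ap ax; rewrite /lex_le /= ltnn eqxx /=; lia.
Qed.

Lemma card_SE_region w p q : p <= n -> q <= n ->
  #|[set b : 'I_n | (p <= b) && (q <= w b)]%SET| + p + q = rank_entry w p q + n.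
Proof.
move=> pn qn.
pose A := [set b : 'I_n | b < p]%SET; pose B := [set b : 'I_n | w b < q]%SET.
have card_lt m : m <= n -> #|[set b : 'I_n | b < m]%SET| = m.
  by move=> mn; rewrite -sum1dep_card (big_ord_narrow mn) sum1_card card_ord.
have cA : #|A| = p by apply: card_lt.
have cB : #|B| = q.
  rewrite -(card_lt q qn) -[RHS](card_imset _ (@perm_inj _ w^-1%g)); apply: eq_card => b.
  rewrite inE; apply/idP/imsetP => [bq|[c]]; last by rewrite inE => cq ->; rewrite permKV.
  by exists (w b); rewrite ?inE ?permK.
have -> : rank_entry w p q = #|A :&: B|.
  by apply: eq_card => b; rewrite !inE.
have -> : [set b : 'I_n | (p <= b) && (q <= w b)]%SET = ~: (A :|: B).
  by apply/setP => b; rewrite !inE negb_or -!leqNgt.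
have := cardsUI A B; have := cardsC (A :|: B); rewrite card_ord cA cB; lia.
Qed.

Definition new_dots w i : {set 'I_n} :=
  [set a : 'I_n in NW w i | ~~ [exists j : 'I_i, a \in NW w j]]%SET.

Lemma pillar_kE w i : pillar_k w i = (#|new_dots w i|)%:Z%R.
Proof.
rewrite /pillar_k /pillar_val /pillar_L -[rank_entry _ _ _]/(#|NW w i|).
rewrite -(cardsID [set a : 'I_n | [exists j : 'I_i, a \in NW w j]]%SET (NW w i)).
have -> : NW w i :\: [set a : 'I_n | [exists j : 'I_i, a \in NW w j]]%SET = new_dots w i.
  by apply/setP => a; rewrite !inE andbC.
have -> : NW w i :&: [set a : 'I_n | [exists j : 'I_i, a \in NW w j]]%SET =
    [set a : 'I_n in NW w i | [exists j : 'I_i, a \in NW w j]]%SET.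
  by apply/setP => a; rewrite !inE.
by rewrite PoszD GRing.addrAC GRing.subrr GRing.add0r.
Qed.

Lemma pillar_nth w i : i < size (pillars w) ->
  is_pillar w (pillar_row w i) (pillar_col w i).
Proof.
by move=> ip; rewrite -mem_pillars /pillar_row /pillar_col -surjective_pairing mem_nth.
Qed.

Lemma new_dots_SE_dots w i a : i < size (pillars w) -> a \in new_dots w i ->
  #|SE_dots w a| + pillar_row w i + pillar_col w i = pillar_val w i + n.
Proof.
move=> ip; rewrite 2!inE => /andP [/andP [ar ac] /existsPn old].
have pi := pillar_nth ip.
rewrite (@first_pillar_SE_dots w a (pillar_row w i) (pillar_col w i)).
  have [/andP [_ rn] /andP [_ cn]] :
      1 <= pillar_row w i <= n.-1 /\ 1 <= pillar_col w i <= n.-1.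
    by case/and3P: pi.
  by apply: card_SE_region; lia.
split=> // p q pq ap aq.
have pqs : (p, q) \in pillars w by rewrite mem_pillars.
have ij : i <= index (p, q) (pillars w).
  rewrite leqNgt; apply/negP => ji; have := old (Ordinal ji).
  by rewrite inE /pillar_row /pillar_col /= nth_index //= ap aq.
move: ij; rewrite leq_eqVlt => /orP [/eqP ij|ij].
  by rewrite /pillar_row /pillar_col ij nth_index // /lex_le /= eqxx leqnn orbT.
have := pairwiseP (0, 0) (pillars_lex w) i _ ip _ ij.
by rewrite nth_index // inE index_mem => /(_ pqs); rewrite /pillar_row /pillar_col; case: nth.
Qed.

(** Dots with a dot South-East of them lie in some North-West region. *)
Lemma new_dots_uniq w a : 0 < #|SE_dots w a| ->
  exists i, forall j : 'I_(size (pillars w)), (a \in new_dots w j) = (j == i).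
Proof.
case/card_gt0P => b; rewrite inE => /andP [ab wab].
have [p [q [pq ap _ aq _]]] := pillar_between ab wab.
have ex : exists i, (i < size (pillars w)) && (a \in NW w i).
  exists (index (p, q) (pillars w)); rewrite index_mem mem_pillars pq inE.
  by rewrite /pillar_row /pillar_col nth_index ?mem_pillars // ap aq.
case: (ex_minnP ex) => i /andP [ip ai] imin; exists (Ordinal ip) => j.
rewrite inE; apply/andP/eqP => [[aj /existsPn old]|->]; last first.
  split=> //; apply/existsPn => k; apply/negP => ak.
  have := imin k; rewrite ak andbT (ltn_trans (ltn_ord k) ip) => /(_ isT).
  by rewrite leqNgt ltn_ord.
apply/val_inj/eqP; rewrite /= eqn_leq (imin j) ?ltn_ord ?aj // andbT leqNgt.
by apply/negP => ij; have := old (Ordinal ij); rewrite ai.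
Qed.

Lemma sum_new_dots w :
  \sum_(i < size (pillars w)) \sum_(a in new_dots w i) #|SE_dots w a| = \sum_a #|SE_dots w a|.
Proof.
rewrite (exchange_big_dep predT) //=; apply: eq_bigr => a _.
case: (posnP #|SE_dots w a|) => [->|/new_dots_uniq [i iP]]; first by rewrite big1.
by rewrite (eq_bigl (pred1 i)) ?big_pred1_eq // => j; rewrite iP.
Qed.

Theorem pillar_sum w :
  (\sum_(i < size (pillars w))
       pillar_k w i * ((pillar_val w i)%:Z + n%:Z
                       - (pillar_row w i)%:Z - (pillar_col w i)%:Z) =
   (\sum_a #|SE_dots w a|)%N%:Z)%R.
Proof.
rewrite -sum_new_dots (big_morph Posz PoszD (erefl _)); apply: eq_bigr => i _.
rewrite pillar_kE (big_morph Posz PoszD (erefl _)); set c : int := (_ - _ - _)%R.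
rewrite (eq_bigr (fun=> c)) => [|a an]; last first.
  by have := new_dots_SE_dots (ltn_ord i) an; rewrite /c; lia.
by rewrite GRing.sumr_const -GRing.mulr_natl natz.
Qed.

Lemma sum_card_SE_dots w : \sum_a #|SE_dots w a| + #|inv_set w| = #|inv_set (longest n)|.
Proof.
rewrite inv_set_longest; set U := [set t | _]%SET.
pose N := [set t : 'I_n * 'I_n | (t.1 < t.2) && (w^-1%g t.1 < w^-1%g t.2)]%SET.
have -> : \sum_a #|SE_dots w a| = #|N|.
  pose f (t : 'I_n * 'I_n) := (w t.1, w t.2).
  have fI : injective f by move=> [a b] [c d] [/perm_inj -> /perm_inj ->].
  under eq_bigr do rewrite -sum1_card.
  rewrite pair_big_dep /= sum1dep_card -(card_imset _ fI); apply: eq_card => -[c d].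
  rewrite inE /=; apply/imsetP/idP => [[[a b]]|/andP [cd vcd]].
    by rewrite !inE /= => /andP [ab wab] [-> ->]; rewrite !permK ab wab.
  by exists (w^-1%g c, w^-1%g d); rewrite ?inE /f /= !permKV // cd vcd.
rewrite addnC -(cardsID (inv_set w) U); congr (_ + _); apply: eq_card => -[a b].
  by rewrite !inE /= andbA andbb.
rewrite !inE /=; case: (ltnP a b) => //= ab; rewrite ?andbF // andbT -leqNgt ltn_neqAle.
by rewrite andb_idl // => _; apply/eqP => /val_inj/perm_inj e; rewrite e ltnn in ab.
Qed.

End PillarCount.

Theorem theorem4p8 (R : realType) (n : nat) (w : 'S_n) :
  has_codim (schubert_cell R w)
    (\sum_(i < size (pillars w))
       pillar_k w i * ((pillar_val w i)%:Z + n%:Z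
                       - (pillar_row w i)%:Z - (pillar_col w i)%:Z)).
Proof.
exists #|inv_set w|, #|inv_set (longest n)|; split.
- exact: krull_dim_schubert_cell.
- exact: krull_dim_flag_variety.
by rewrite pillar_sum -(sum_card_SE_dots w) PoszD addrK.
Qed.
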